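(* Let $K$ be a field and let $u=x_1^{a_1}x_2^{a_2}x_3^{a_3}\in K[x_1,x_2,x_3]$ with $a_i\ge 0$ for $i=1,2$ and $a_3\ge 1$. Then $B(u)$ is Freiman if and only if $a_3=1$, or $a_3=2$ and $a_2=0$.
   Context: Let $S=K[x_1,x_2,x_3]$ and $\mathfrak m=(x_1,x_2,x_3)$. For a monomial ideal $I$, $G(I)$ denotes its unique minimal set of monomial generators; for a monomial $u$, $\operatorname{supp}(u)=\{i\mid x_i \text{ divides } u\}$. A monomial ideal $I\subset S$ is strongly stable if for all $u\in G(I)$, all $j\in\operatorname{supp}(u)$ and all $i<j$ one has $x_i(u/x_j)\in I$. For a monomial $u$, the principal Borel ideal $B(u)$ is the unique smallest strongly stable ideal containing $u$. For a graded ideal $I\subset S$, $\mu(I)$ denotes the minimal number of generators of $I$; the fiber cone is $F(I)=\bigoplus_{k\ge 0} I^k/\mathfrak m I^k$, and the analytic spread $\ell(I)$ is the Krull dimension of $F(I)$. A monomial ideal $I$ that is equigenerated (minimally generated by monomials of one degree) is called Freiman if $\mu(I^2)=\ell(I)\mu(I)-\binom{\ell(I)}{2}$. *)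

(* Defs.v *)
From HB Require Import structures.
From mathcomp Require Import all_boot all_order all_algebra.
From mathcomp Require Import boolp classical_sets.
From mathcomp Require Import mpoly.

Set Implicit Arguments.
Unset Strict Implicit.
Unset Printing Implicit Defensive.

Import GRing.Theory.

Local Open Scope ring_scope.
Local Open Scope classical_set_scope.

Section IdealOperations.
Variable R : comNzRingType.
Implicit Types (A B I : set R) (k n : nat).

(* The ideal generated by A; a pair in s is (coefficient, element of A). *)
Definition ideal_gen A : set R :=
  [set f | exists2 s : seq (R * R),
     (forall x, x \in s -> A x.2) & f = \sum_(x <- s) x.1 * x.2].

Definition ideal_mul A B : set R :=
  ideal_gen [set f * g | f in A & g in B].

Fixpoint ideal_exp I k : set R :=
  if k is k'.+1 then ideal_mul I (ideal_exp I k') else setT.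

Definition has_num_gens I n : Prop :=
  exists2 s : seq R, I = ideal_gen [set` s] & size s = n.

(* is_mu I n means mu(I) = n. *)
Definition is_mu I n : Prop :=
  has_num_gens I n /\ forall k, has_num_gens I k -> (n <= k)%N.

Lemma ideal_gen_sub A : A `<=` ideal_gen A.
Proof.
move=> f Af; exists [:: (1, f)]; last by rewrite big_seq1 mul1r.
by move=> x; rewrite inE => /eqP->.
Qed.

Lemma ideal_gen0 A : ideal_gen A 0.
Proof. by exists [::]; rewrite ?big_nil. Qed.

Lemma ideal_genD A f g : ideal_gen A f -> ideal_gen A g -> ideal_gen A (f + g).
Proof.
move=> [s As ->] [t At ->]; exists (s ++ t); last by rewrite big_cat.
by move=> x; rewrite mem_cat => /orP[/As|/At].
Qed.

Lemma ideal_genM A c f : ideal_gen A f -> ideal_gen A (c * f).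
Proof.
move=> [s As ->]; exists [seq (c * x.1, x.2) | x <- s].
  by move=> _ /mapP[x /As Ax ->].
by rewrite big_map mulr_sumr; apply: eq_bigr => x _; rewrite mulrA.
Qed.

Lemma ideal_gen_sum A (T : eqType) (r : seq T) (F : T -> R) :
  (forall x, x \in r -> ideal_gen A (F x)) ->
  ideal_gen A (\sum_(x <- r) F x).
Proof.
elim: r => [|x r IHr] AF; first by rewrite big_nil; exact: ideal_gen0.
rewrite big_cons; apply: ideal_genD; first by apply: AF; rewrite mem_head.
by apply: IHr => y ry; apply: AF; rewrite inE ry orbT.
Qed.

Lemma ideal_gen_min A B :
  (forall x, A x -> ideal_gen B x) -> ideal_gen A `<=` ideal_gen B.
Proof.
move=> AB _ [s As ->]; apply: ideal_gen_sum => x sx.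
exact/ideal_genM/AB/As.
Qed.

Lemma ideal_mulM A B f g : A f -> B g -> ideal_mul A B (f * g).
Proof. by move=> Af Bg; apply: ideal_gen_sub; exists f => //; exists g. Qed.

Lemma ideal_exp0 I k : ideal_exp I k 0.
Proof. by case: k => //= k; exact: ideal_gen0. Qed.

Lemma ideal_expD I k f g :
  ideal_exp I k f -> ideal_exp I k g -> ideal_exp I k (f + g).
Proof. by case: k => //= k; exact: ideal_genD. Qed.

Lemma ideal_expZ I k c f : ideal_exp I k f -> ideal_exp I k (c * f).
Proof. by case: k => //= k; exact: ideal_genM. Qed.

Lemma ideal_expM I j k f g :
  ideal_exp I j f -> ideal_exp I k g -> ideal_exp I (j + k) (f * g).
Proof.
elim: j f => [|j IHj] f /=; first by move=> _; exact: ideal_expZ.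
move=> [s sI ->] Ig; rewrite mulr_suml; apply: ideal_gen_sum => x /sI.
move=> [a Ia [b Ib <-]]; rewrite -mulrA; apply: ideal_genM.
by rewrite -mulrA; apply: ideal_mulM => //; exact: IHj.
Qed.

Lemma ideal_exp_mul B I j k f g :
  ideal_exp I j f -> ideal_mul B (ideal_exp I k) g ->
  ideal_mul B (ideal_exp I (j + k)) (f * g).
Proof.
move=> If [s sB ->]; rewrite mulr_sumr; apply: ideal_gen_sum => x /sB.
move=> [b Bb [h Ih <-]]; rewrite mulrCA; apply: ideal_genM.
by rewrite mulrCA; apply: ideal_mulM => //; exact: ideal_expM.
Qed.

End IdealOperations.

Section KrullDimension.
Variable R : comNzRingType.

(* A strictly increasing chain P_0 < ... < P_e of prime ideals. *)
Definition has_prime_chain (e : nat) : Prop :=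
  exists P : 'I_e.+1 -> prime_idealr R, forall i j : 'I_e.+1, (i < j)%N ->
    {subset P i <= P j} /\ exists2 x, x \in P j & x \notin P i.

Definition is_krull_dim (d : nat) : Prop :=
  has_prime_chain d /\ forall e, has_prime_chain e -> (e <= d)%N.

End KrullDimension.

(* The fiber cone is built as the quotient of the direct sum of the I^k,      *)
(* realised as the subring {p | p`_k \in I^k for all k} of S[t], by the       *)
(* direct sum of the m I^k, i.e. as the direct sum of the I^k / m I^k with    *)
(* the product induced by I^j * I^k <= I^(j + k).                             *)
Section FiberCone.
Variables (n : nat) (K : fieldType).
Local Notation S := {mpoly K[n]}.

Definition maxideal : set S := ideal_gen [set 'X_i | i in [set: 'I_n]].

Variable I : set S.

Definition rees_pred : pred {poly S} :=
  fun p => `[< forall k, ideal_exp I k p`_k >].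

Lemma rees_subring_closed : subring_closed rees_pred.
Proof.
have reesN p : p \in rees_pred -> - p \in rees_pred.
  move=> /asboolP Ip; apply/asboolP => k.
  by rewrite coefN -mulN1r; exact/ideal_expZ.
split=> [|p q Ip /reesN/asboolP Iq|p q /asboolP Ip /asboolP Iq].
- apply/asboolP => -[|k]; first by rewrite /=.
  by rewrite coef1; exact: ideal_exp0.
- apply/asboolP => k; rewrite coefD; apply: ideal_expD; last exact: Iq.
  by move/asboolP: Ip.
apply/asboolP => k; rewrite coefM.
elim/big_ind: _ => [|f g|i _]; [exact: ideal_exp0|exact: ideal_expD|].
by rewrite -[X in ideal_exp _ X](subnKC (leq_ord i)); exact: ideal_expM.
Qed.

HB.instance Definition _ :=
  GRing.isSubringClosed.Build {poly S} rees_pred rees_subring_closed.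

Record rees := Rees { rees_val : {poly S}; _ : rees_val \in rees_pred }.

HB.instance Definition _ := [isSub for rees_val].
HB.instance Definition _ := [Choice of rees by <:].
HB.instance Definition _ := [SubChoice_isSubComNzRing of rees by <:].

Definition fiber_ideal : pred rees :=
  fun p => `[< forall k, ideal_mul maxideal (ideal_exp I k) (val p)`_k >].

Lemma maxideal_eval0 f : maxideal f -> f.@[fun=> 0] = 0.
Proof.
move=> [s sX ->]; rewrite raddf_sum big_seq big1 // => x /sX[i _ <-].
by rewrite /= mevalM mevalXU mulr0.
Qed.

Lemma fiber_ideal_closed : idealr_closed fiber_ideal.
Proof.
split=> [||p q r /asboolP Iq /asboolP Ir].
- by apply/asboolP => k; rewrite raddf0 coef0; exact: ideal_gen0.
- apply/asboolP => /(_ 0); rewrite rmorph1 coef1 /= => -[s sI] /(congr1 (meval (fun=> 0))).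
  rewrite meval1 raddf_sum big_seq big1 => [/eqP|x /sI[f mf [g _ <-]]].
    by rewrite oner_eq0.
  by rewrite /= !mevalM (maxideal_eval0 mf) mul0r mulr0.
apply/asboolP => k; rewrite rmorphD rmorphM coefD coefM.
apply: ideal_genD; last exact: Ir.
elim/big_ind: _ => [|f g|i _]; [exact: ideal_gen0|exact: ideal_genD|].
rewrite -[X in ideal_exp _ X](subnKC (leq_ord i)); apply: ideal_exp_mul => //.
by have /asboolP := valP p.
Qed.

HB.instance Definition _ := isIdealr.Build rees fiber_ideal fiber_ideal_closed.

Definition fiber_idealr : idealr rees := fiber_ideal.

Definition fiber_cone : comNzRingType := {ideal_quot fiber_idealr}.

(* is_analytic_spread l means l(I) = l. *)
Definition is_analytic_spread (l : nat) : Prop := is_krull_dim fiber_cone l.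

End FiberCone.

(* Monomials are represented by their exponent vectors m : 'X_{1..n}, the     *)
(* variables x_1, ..., x_n being indexed by 0, ..., n - 1.                    *)
Section MonomialIdeals.
Variables (n : nat) (K : fieldType).
Implicit Types (I : set {mpoly K[n]}) (G : set 'X_{1..n}).

Definition monomial_ideal_gen G : set {mpoly K[n]} :=
  ideal_gen [set 'X_[m] | m in G].

(* G = G(I); its existence says in particular that I is a monomial ideal. *)
Definition is_min_mon_gens I G : Prop :=
  I = monomial_ideal_gen G /\
  forall G', G' `<=` G -> I = monomial_ideal_gen G' -> G' = G.

Definition strongly_stable I : Prop :=
  exists2 G, is_min_mon_gens I G &
    forall u, G u -> forall j : 'I_n, (0 < u j)%N ->
    forall i : 'I_n, (i < j)%N -> I 'X_[(u - U_(j) + U_(i))%MM].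

Definition principal_borel (u : 'X_{1..n}) : set {mpoly K[n]} :=
  \bigcap_(I in [set I | strongly_stable I /\ I 'X_[u]]) I.

Definition equigenerated I : Prop :=
  exists2 G, is_min_mon_gens I G &
    exists d, forall m, G m -> mdeg m = d.

Definition freiman I : Prop :=
  equigenerated I /\
  exists l mu1 mu2 : nat,
    [/\ is_analytic_spread I l, is_mu I mu1, is_mu (ideal_exp I 2) mu2 &
        mu2%:Z = l%:Z * mu1%:Z - 'C(l, 2)%:Z].

Lemma monomial_ideal_genP G f : monomial_ideal_gen G f <->
  forall m, m \in msupp f -> exists2 g, G g & (g <= m)%MM.
Proof.
split=> [[s sG ->] m|fG].
  rewrite mcoeff_msupp => /eqP sum_neq0.
  case: (pselect (exists2 g, G g & (g <= m)%MM)) => // noG.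
  case: sum_neq0; rewrite raddf_sum big_seq big1 // => x /sG[g Gg <-] /=.
  apply/eqP; rewrite mcoeff_eq0 (perm_mem (msuppMX _ _)).
  apply/negP => /mapP[k _ mE].
  by apply: noG; exists g => //; rewrite mE lem_addr.
rewrite [X in monomial_ideal_gen _ X]mpolyE; apply: ideal_gen_sum => m /fG[g Gg le_gm].
rewrite -mul_mpolyC -(submK le_gm) mpolyXD mulrA; apply: ideal_genM.
by apply: ideal_gen_sub; exists g.
Qed.

Lemma monomial_ideal_genX G m :
  monomial_ideal_gen G 'X_[m] <-> exists2 g, G g & (g <= m)%MM.
Proof.
rewrite monomial_ideal_genP; split=> [|Gm k]; first by apply; rewrite msuppX inE.
by rewrite msuppX inE => /eqP ->.
Qed.

Lemma monomial_ideal_gen_supp G f : monomial_ideal_gen G f <->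
  forall m, m \in msupp f -> monomial_ideal_gen G 'X_[m].
Proof.
by rewrite monomial_ideal_genP; split=> Gf m /Gf /monomial_ideal_genX.
Qed.

Lemma min_mon_gens_exist G :
  exists H, is_min_mon_gens (monomial_ideal_gen G) H.
Proof.
pose H := [set m | G m /\ forall g, G g -> (g <= m)%MM -> g = m].
have below d m : (mdeg m < d)%N -> G m -> exists2 h, H h & (h <= m)%MM.
  elim: d m => // d IHd m le_md Gm.
  case: (pselect (exists g, [/\ G g, (g <= m)%MM & g <> m])) => [|noG].
    move=> [g [Gg le_gm neq_gm]].
    have [|//|h Hh le_hg] := IHd g; last by exists h => //; exact: lepm_trans le_gm.
    apply: (@leq_trans (mdeg m)) => //.
    rewrite -(submK le_gm) mdegD -[X in (X < _)%N]add0n ltn_add2r lt0n mdeg_eq0; apply/eqP => mg0.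
    by apply: neq_gm; rewrite -[RHS](submK le_gm) mg0 add0m.
  exists m; last exact: lepm_refl.
  split=> // g Gg le_gm; case: (pselect (g = m)) => // neq_gm.
  by case: noG; exists g.
have belowG m : G m -> exists2 h, H h & (h <= m)%MM by exact: below (ltnSn _).
exists H; split=> [|H' H'H GH'].
  apply/seteqP; split=> f /monomial_ideal_genP fG; apply/monomial_ideal_genP.
    move=> m /fG[g /belowG[h Hh le_hg] le_gm].
    by exists h => //; exact: lepm_trans le_gm.
  by move=> m /fG[g [Gg _] le_gm]; exists g.
apply/seteqP; split=> // m [Gm minm].
have : monomial_ideal_gen G 'X_[m].
  by apply/monomial_ideal_genX; exists m => //; exact: lepm_refl.
rewrite GH' => /monomial_ideal_genX[h H'h le_hm].
by have [Gh _] := H'H _ H'h; rewrite -(minm h).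
Qed.

Lemma strongly_stableX I u (i j : 'I_n) : strongly_stable I ->
  I 'X_[u] -> (0 < u j)%N -> (i < j)%N -> I 'X_[(u - U_(j) + U_(i))%MM].
Proof.
move=> [G [IG _] stabG] Iu uj lt_ij.
move: Iu; rewrite IG => /monomial_ideal_genX[g Gg le_gu].
have [gj|] := posnP (g j).
  apply/monomial_ideal_genX; exists g => //.
  apply/mnm_lepP => k; rewrite mnmDE mnmBE !mnm1E.
  have := mnm_lepP le_gu k; case: (j =P k) => [<-|_].
    by rewrite gj.
  by rewrite subn0 => /leq_trans; apply; exact: leq_addr.
move=> gj; have := stabG g Gg j gj i lt_ij; rewrite IG.
move=> /monomial_ideal_genX[h Gh le_h]; apply/monomial_ideal_genX; exists h => //.
apply: lepm_trans le_h _; apply/mnm_lepP => k; rewrite !mnmDE !mnmBE.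
by rewrite leq_add2r leq_sub2r // (mnm_lepP le_gu).
Qed.

Lemma principal_borelP u :
  [/\ strongly_stable (principal_borel u), principal_borel u 'X_[u] &
      forall I, strongly_stable I -> I 'X_[u] -> principal_borel u `<=` I].
Proof.
split=> [||I stI Iu f]; [|by move=> I []|by apply].
set B := principal_borel u; pose M := [set m | B 'X_[m]].
have BM : B = monomial_ideal_gen M.
  apply/seteqP; split=> f.
    move=> Bf; apply/monomial_ideal_genP => m fm; exists m; last exact: lepm_refl.
    move=> I [stI Iu]; have := Bf I (conj stI Iu).
    by case: stI => G [-> _] _ /monomial_ideal_gen_supp; exact.
  move=> Mf I [stI Iu]; have [G [IG _] _] := stI; rewrite IG.
  apply/monomial_ideal_gen_supp => m fm; rewrite -IG.
  have /monomial_ideal_genP/(_ m fm)[g Bg le_gm] := Mf.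
  have := Bg I (conj stI Iu); rewrite IG => /monomial_ideal_genX[h Gh le_hg].
  by apply/monomial_ideal_genX; exists h => //; exact: lepm_trans le_gm.
have [H BH] := min_mon_gens_exist M; rewrite -BM in BH.
exists H => // m Hm j mj i lt_ij I [stI Iu].
apply: strongly_stableX => //.
suff Bm : B 'X_[m] by apply: Bm.
by rewrite BH.1; apply/monomial_ideal_genX; exists m => //; exact: lepm_refl.
Qed.

End MonomialIdeals.

Arguments principal_borel {n} K u _.

(* Main.v *)
Require Import Defs.
From HB Require Import structures.
From mathcomp Require Import all_boot all_order all_algebra.
From mathcomp Require Import boolp classical_sets.
From mathcomp Require Import mpoly zify ring.

(** The ideal [B(u)] has minimal generators in one degree [d = a1 + a2 + a3]:
they are the monomials [m] of degree [d] with [m3 <= a3] and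
[m2 + m3 <= a2 + a3], because moving one unit of exponent at a time to an
earlier variable leads from [u] to each of them, and such moves preserve the
two inequalities ([principal_borelE]).  Halving exponents shows that [B(u)^2]
is described in the same way with doubled bounds ([borel_seq_square]).  For a
monomial ideal generated in one degree, [mu] is the number of monomial
generators ([is_mu_monomial]), so that, counting lattice points in a trapezoid,
[2 mu(B(u)) = (a3 + 1) (2 a2 + a3 + 2)] and
[2 mu(B(u)^2) = (2 a3 + 1) (4 a2 + 2 a3 + 2)].

The analytic spread is 3.  When [I] is generated by monomials of one degree
[d > 0], the quotient [I^k / m I^k] only remembers the forms of degree [k d] in
[I^k]; sending a class to the sum of these forms embeds the fiber cone into
[K[x_1, ..., x_n]] ([fiber_cone_embedding]).  The Krull dimension is then at
most [n]: picking [y_i] in [P_(i+1)] but not in [P_i] along a chain of primes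
gives elements that satisfy no polynomial relation over [K]
([prime_chain_independent], by looking at the lexicographically lowest term),
whereas [n + 1] polynomials in [n] variables always satisfy one
([algebraic_dependence], by counting monomials).  It is at least [n] as soon as
[I] contains every [x_1^(d-1) x_i], since killing the last variables one after
the other then yields a strict chain of primes ([analytic_spread_monomial]).

With [l = 3] the Freiman equation becomes
[mu(B(u)^2) = 3 mu(B(u)) - 3], that is [(a3 - 1) (2 a2 + a3 - 2) = 0]. *)

Set Implicit Arguments.
Unset Strict Implicit.
Unset Printing Implicit Defensive.

Import GRing.Theory.

(** * Algebraic dependence of n + 1 polynomials in n variables *)

Section AlgebraicDependence.
Local Open Scope ring_scope.
Variables (n : nat) (K : fieldType).
Implicit Types (p q : {mpoly K[n]}) (m : 'X_{1..n}).

Definition mdeg_le p D := forall m, m \in msupp p -> (mdeg m <= D)%N.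

Lemma mdeg_le_M p q D E : mdeg_le p D -> mdeg_le q E -> mdeg_le (p * q) (D + E).
Proof.
move=> pD qE m /msuppM_le/allpairsP[[k l] /= [/pD kD /qE lE ->]].
by rewrite mdegD leq_add.
Qed.

Lemma mdeg_le_1 : mdeg_le 1 0.
Proof. by move=> m; rewrite msupp1 inE => /eqP->; rewrite mdeg0. Qed.

Lemma mdeg_le_X p D k : mdeg_le p D -> mdeg_le (p ^+ k) (k * D).
Proof.
move=> pD; elim: k => [|k IHk]; first by rewrite expr0; exact: mdeg_le_1.
by rewrite exprS mulSn; exact: mdeg_le_M.
Qed.

Lemma mdeg_le_prod (I : finType) (f : I -> {mpoly K[n]}) (D : I -> nat) :
  (forall i, mdeg_le (f i) (D i)) -> mdeg_le (\prod_i f i) (\sum_i D i).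
Proof.
move=> fD; elim/big_ind2: _ => [|p k q l|i _]; first exact: mdeg_le_1.
  exact: mdeg_le_M.
exact: fD.
Qed.

(** Indexing the rows and columns of a matrix by finite types saves the
numbering of monomials when this is applied to coefficients of polynomials. *)
Lemma nontrivial_relation (T U : finType) (F : T -> U -> K) :
  (#|U| < #|T|)%N ->
  exists2 c : T -> K, exists t, c t != 0 & forall u, \sum_t c t * F t u = 0.
Proof.
move=> ltUT.
pose A := \matrix_(i < #|T|, j < #|U|) F (enum_val i) (enum_val j).
have kerA0 : kermx A != 0.
  rewrite -mxrank_eq0 mxrank_ker subn_eq0 -ltnNge.
  exact: leq_ltn_trans (rank_leq_col A) ltUT.
have /rV0Pn[i vi0] : nz_row (kermx A) != 0 by rewrite nz_row_eq0.
pose v := nz_row (kermx A).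
have vA : v *m A = 0 by apply/eqP; rewrite -sub_kermx nz_row_sub.
exists (fun t => v 0 (enum_rank t)); first by exists (enum_val i); rewrite enum_valK.
move=> u; transitivity ((v *m A) 0 (enum_rank u)); last by rewrite vA mxE.
rewrite mxE (reindex (@enum_val T predT)) /=; last first.
  by apply: onW_bij; exact: enum_val_bij.
by apply: eq_bigr => j _; rewrite !mxE enum_valK enum_rankK.
Qed.

(** The [N^(n+1)] products of the [f i] with exponents below [N] have degree
[O(N)], hence involve only [O(N^n)] monomials: for [N] large they are linearly
dependent. *)
Lemma algebraic_dependence (f : 'I_n.+1 -> {mpoly K[n]}) :
  exists (N : nat) (c : {ffun 'I_n.+1 -> 'I_N} -> K),
    (exists a, c a != 0) /\
    \sum_a c a *: \prod_i f i ^+ a i = 0.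
Proof.
pose D := (\max_i msize (f i))%N.
have fD i : mdeg_le (f i) D.
  move=> m /msize_mdeg_lt/ltnW/leq_trans; apply.
  exact: (leq_bigmax (F := fun i => msize (f i))).
(* Products with exponents below N have degree at most (n + 1) N D < N C = M,
   and (N C)^n < N^(n+1) as soon as C^n < N. *)
pose C := (n.+1 * D).+1; pose N := (C ^ n).+1; pose M := (N * C)%N.
pose mon (b : {ffun 'I_n -> 'I_M}) : 'X_{1..n} := [multinom (b i : nat) | i < n].
have [|c cnz crel] := @nontrivial_relation
    {ffun 'I_n.+1 -> 'I_N} {ffun 'I_n -> 'I_M}
    (fun a b => (\prod_i f i ^+ a i)@_(mon b)).
  rewrite !card_ffun !card_ord /M expnMn expnS mulnC ltn_pmul2r ?expn_gt0 //.
exists N, c; split=> //; apply/mpolyP => m; rewrite mcoeff0 raddf_sum /=.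
under eq_bigr do rewrite mcoeffZ.
case: (ltnP (mdeg m) M) => [ltmM|leMm].
  have mM i : (m i < M)%N.
    by apply: leq_ltn_trans ltmM; rewrite mdegE (bigD1 i) //= leq_addr.
  rewrite -[RHS](crel [ffun i => Ordinal (mM i)]).
  suff -> : mon [ffun i => Ordinal (mM i)] = m by [].
  by apply/mnmP => i; rewrite mnmE ffunE.
apply: big1 => a _; rewrite memN_msupp_eq0 ?mulr0 //; apply/negP.
have degf i : mdeg_le (f i ^+ a i) (N * D).
  move=> k /(mdeg_le_X (fD i))/leq_trans; apply.
  by rewrite leq_mul2r ltnW ?orbT.
move=> /(mdeg_le_prod degf); rewrite sum_nat_const card_ord => le_m.
have := leq_trans leMm le_m; rewrite /M /C mulnCA mulnS leqNgt.
by rewrite -[X in (X < _)%N]add0n ltn_add2r.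
Qed.

End AlgebraicDependence.

(** * Bounding the length of chains of primes *)

Section PrimeChains.
Local Open Scope ring_scope.

(** A polynomial relation is lost at its lexicographically lowest term: if [k] is
the least exponent of [x 0] in the relation, then dividing by [x 0 ^+ k], which
avoids the prime [P 0], and reducing modulo [x 0], which lies in [P 1], leaves a
relation modulo [P 1] between [x 1, ..., x e.-1] with the same coefficients.
With no variable left, a unit would lie in a prime.  Terms are indexed by a
finite type, with [a t i] the exponent of [x i] in the term [t], so that the
induction only shifts [a], [x] and [P]. *)
Lemma prime_chain_independent (F : comNzRingType) (T : finType) (e : nat) :
  forall (P : nat -> prime_idealr F) (x : nat -> F) (A : {set T})
    (c : T -> F) (a : T -> nat -> nat),
  (forall i, (i < e)%N ->
     [/\ {subset P i <= P i.+1}, x i \in P i.+1 & x i \notin P i]) ->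
  A != finset.set0 -> (forall t, t \in A -> exists d, d * c t = 1) ->
  {in A &, forall t u, (forall i, (i < e)%N -> a t i = a u i) -> t = u} ->
  \sum_(t in A) c t * \prod_(i < e) x i ^+ a t i \notin P 0.
Proof.
elim: e => [|e IHe] P x A c a chain A0 cunit ainj.
  have /set0Pn[t tA] := A0.
  have -> : A = [set t].
    apply/setP => u; rewrite !inE; apply/idP/eqP => [uA|-> //].
    exact: ainj.
  rewrite big_set1 big_ord0 mulr1; have [d d1] := cunit t tA.
  by apply/negP => /(@idealMr _ (P 0) d); rewrite d1 idealr1.
have /set0Pn[t0 t0A] := A0.
(* B collects the terms with the least exponent k of x 0. *)
have [t1 t1A kmin] : exists2 t1, t1 \in A & forall t, t \in A -> (a t1 0 <= a t 0)%N.
  by case: (@arg_minnP _ t0 (mem A) (fun t => a t 0%N)) => // t1; exists t1.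
set k := a t1 0%N in kmin.
pose B := [set t in A | a t 0%N == k].
have [P01 x1 x0] := chain 0%N isT.
pose y t := c t * \prod_(i < e) x i.+1 ^+ a t i.+1.
pose z := \sum_(t in A :\: B) x 0%N ^+ (a t 0 - k).-1 * y t.
have -> : \sum_(t in A) c t * \prod_(i < e.+1) x i ^+ a t i =
    x 0%N ^+ k * (\sum_(t in B) y t + x 0%N * z).
  have BA : A :&: B = B.
    by apply/finset.setIidPr/fintype.subsetP => t; rewrite inE => /andP[].
  rewrite (big_setID B) /= BA mulrDr mulrA -exprSr !mulr_sumr; congr (_ + _).
    apply: eq_bigr => t; rewrite inE => /andP[_ /eqP tk].
    by rewrite big_ord_recl /= tk mulrCA.
  apply: eq_bigr => t; rewrite !inE negb_and => /andP[/orP[/negbTE -> //|tk] tA].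
  rewrite big_ord_recl /= mulrCA [RHS]mulrA -exprD; congr (x _ ^+ _ * _).
  move: (kmin t tA) tk; move: (a t 0%N) => j; rewrite neq_ltn; lia.
apply/negP; rewrite prime_idealrM => /orP[|/P01].
  elim: (k) => [|j IHj]; first by rewrite expr0 idealr1.
  by rewrite exprS prime_idealrM (negbTE x0).
have xz : x 0%N * z \in P 1%N by rewrite mulrC idealMr.
move=> Pyz; have : \sum_(t in B) y t \in P 1%N.
  by rewrite -[X in X \in _](addrK (x 0%N * z)) rpredB.
apply/negP; apply: (IHe (fun i => P i.+1) (fun i => x i.+1) B c (fun t i => a t i.+1)).
- by move=> i ltie; exact: chain.
- by apply/set0Pn; exists t1; rewrite inE t1A eqxx.
- by move=> t; rewrite inE => /andP[/cunit].
move=> t u; rewrite !inE => /andP[tA /eqP tk] /andP[uA /eqP uk] tu.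
by apply: ainj => // -[|i] ltie; [rewrite tk uk | exact: tu].
Qed.

(** A chain of length at least [n.+1] would give [n.+1] elements whose images in
[K[x_1, ..., x_n]] are algebraically independent. *)
Lemma prime_chain_le (F : comNzRingType) (n : nat) (K : fieldType)
    (Phi : {rmorphism F -> {mpoly K[n]}}) (kappa : K -> F) (e : nat) :
  injective Phi -> (forall c, Phi (kappa c) = c%:MP) ->
  has_prime_chain F e -> (e <= n)%N.
Proof.
move=> Phi_inj PhiK [Q chainQ]; rewrite leqNgt; apply/negP => lt_ne.
pose P i := Q (inord i).
have /choice[x chain] i : exists x, (i < n.+1)%N ->
    [/\ {subset P i <= P i.+1}, x \in P i.+1 & x \notin P i].
  case: (ltnP i n.+1) => [lt_in|_]; last by exists 0.
  have [|sub [x xj xi]] := chainQ (inord i) (inord i.+1); last by exists x.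
  by rewrite !inordK //; lia.
have [N [c [[a0 ca0] rel]]] := algebraic_dependence (fun i : 'I_n.+1 => Phi (x i)).
pose A := [set a | c a != 0].
have /negP[] : \sum_(t in A) kappa (c t) * \prod_(i < n.+1) x i ^+ t (inord i)
    \notin P 0%N.
  apply: (@prime_chain_independent F _ n.+1 P x A (kappa \o c)
    (fun a i => a (inord i) : nat) chain) => [|t|t u _ _ tu].
  - by apply/set0Pn; exists a0; rewrite inE.
  - rewrite inE => ct; exists (kappa (c t)^-1); apply: Phi_inj.
    by rewrite rmorphM !PhiK -mpolyCM mulVf // rmorph1.
  - apply/ffunP => i; apply: val_inj; rewrite /=.
    by have := tu i (ltn_ord i); rewrite inord_val.
rewrite (_ : \sum_(t in A) _ = 0) ?idealr0 //; apply: Phi_inj.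
rewrite rmorph0 -rel raddf_sum [RHS](bigID (mem A)) /= [X in _ = _ + X]big1 => [|t].
  rewrite addr0; apply: eq_bigr => t _; rewrite rmorphM PhiK mul_mpolyC rmorph_prod.
  by congr (_ *: _); apply: eq_bigr => i _; rewrite rmorphXn inord_val.
by rewrite inE negbK => /eqP ->; rewrite scale0r.
Qed.

Lemma kernel_prime (F : comNzRingType) (R : idomainType) (h : {rmorphism F -> R}) :
  exists P : prime_idealr F, forall x, (x \in P) = (h x == 0).
Proof.
pose I : pred F := fun x => h x == 0.
have Ic : idealr_closed I.
  split=> [||a x y]; rewrite !unfold_in /I ?rmorph0 ?rmorph1 ?oner_eq0 //.
  by move=> /eqP hx /eqP hy; rewrite rmorphD rmorphM hx hy mulr0 addr0.
have Ip : prime_idealr_closed I.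
  by move=> x y; rewrite !unfold_in /I rmorphM mulf_eq0.
pose I1 := isIdealr.Build F I Ic; pose I2 := isPrimeIdealrClosed.Build F I Ip.
pose PI : prime_idealr F := HB.pack I I1 I2.
by exists PI.
Qed.

End PrimeChains.
(** * Products of monomial ideals *)

Section MonomialPowers.
Local Open Scope ring_scope.
Local Open Scope classical_set_scope.
Variables (n : nat) (K : fieldType).
Implicit Types (A B G : set 'X_{1..n}) (m : 'X_{1..n}).
Local Notation mon := (@monomial_ideal_gen n K).

Definition mnm_add_set A B : set 'X_{1..n} :=
  [set (a + b)%MM | a in A & b in B].

Fixpoint mnm_mul_set G k : set 'X_{1..n} :=
  if k is k'.+1 then mnm_add_set G (mnm_mul_set G k') else [set 0%MM].

Lemma ideal_mul_monomial A B : ideal_mul (mon A) (mon B) = mon (mnm_add_set A B).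
Proof.
apply/seteqP; split; apply: ideal_gen_min => f.
  move=> [p pA [q qB <-]]; apply/monomial_ideal_genP => m.
  move=> /msuppM_le/allpairsP[[k l] /= [kp lq ->]].
  have /monomial_ideal_genP/(_ k kp)[a Aa le_ak] := pA.
  have /monomial_ideal_genP/(_ l lq)[b Bb le_bl] := qB.
  exists (a + b)%MM; first by exists a => //; exists b.
  by apply/mnm_lepP => i; rewrite !mnmDE leq_add // ?(mnm_lepP le_ak) ?(mnm_lepP le_bl).
move=> [_ [a Aa [b Bb <-]] <-]; rewrite mpolyXD.
by apply: ideal_mulM; apply/monomial_ideal_genX; [exists a|exists b]; rewrite ?lepm_refl.
Qed.

Lemma ideal_exp_monomial G k : ideal_exp (mon G) k = mon (mnm_mul_set G k).
Proof.
elim: k => [|k IHk] /=; last by rewrite IHk ideal_mul_monomial.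
apply/esym/seteqP; split=> // f _; apply/monomial_ideal_genP => m _.
by exists 0%MM => //; apply/mnm_lepP => i; rewrite mnm0E.
Qed.

Lemma maxideal_monomial :
  maxideal (n := n) (K := K) = mon [set U_(i)%MM | i in [set: 'I_n]].
Proof. by rewrite /monomial_ideal_gen image_comp. Qed.

Lemma mnm_mul_set_mdeg G d k m : (forall g, G g -> mdeg g = d) ->
  mnm_mul_set G k m -> mdeg m = (k * d)%N.
Proof.
move=> Gd; elim: k m => [|k IHk] m /=; first by move=> ->; rewrite mdeg0.
by move=> [g Gg [h /IHk hd <-]]; rewrite mdegD Gd // hd.
Qed.

Lemma mdeg_lepm (k m : 'X_{1..n}) : (k <= m)%MM -> (mdeg k <= mdeg m)%N.
Proof. by move=> le_km; rewrite -(submK le_km) mdegD leq_addl. Qed.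

Lemma lepm_mdeg_eq (k m : 'X_{1..n}) : (k <= m)%MM -> mdeg k = mdeg m -> k = m.
Proof.
move=> le_km; rewrite -{1 2}(submK le_km) mdegD => /eqP.
by rewrite -{1}[mdeg k]add0n eqn_add2r eq_sym mdeg_eq0 => /eqP->; rewrite add0m.
Qed.

Lemma lepm_proper (k m : 'X_{1..n}) : (k <= m)%MM -> mdeg k != mdeg m ->
  exists i, (U_(i) + k <= m)%MM.
Proof.
move=> le_km; case: (boolP [exists i, k i < m i]%N) => [/existsP[i lt_i] _|].
  exists i; apply/mnm_lepP => j; rewrite mnmDE mnm1E.
  by case: eqP => [<- //|_]; rewrite add0n (mnm_lepP le_km).
rewrite negb_exists => /forallP ge_km /eqP[]; congr mdeg; apply/mnmP => i.
by apply/eqP; rewrite eqn_leq (mnm_lepP le_km) leqNgt ge_km.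
Qed.

End MonomialPowers.

(** * Lowest forms *)

Section LowestForms.
Local Open Scope ring_scope.
Variables (n : nat) (K : fieldType).
Implicit Types (p q : {mpoly K[n]}) (m : 'X_{1..n}).

Definition mdeg_ge p D := forall m, m \in msupp p -> (D <= mdeg m)%N.

Lemma mcoeff_pihomog d p m :
  (pihomog mdeg d p)@_m = if mdeg m == d then p@_m else 0.
Proof.
rewrite pihomogE raddf_sum [in RHS](mpolyE p) raddf_sum /=.
case: eqP => [md|neq_md]; last first.
  rewrite big1 // => k /eqP kd; rewrite mcoeffZ mcoeffX.
  by case: eqP => [km|_]; [rewrite -km in neq_md | rewrite mulr0].
rewrite [LHS]big_mkcond /=; apply: eq_bigr => k _; rewrite mcoeffZ mcoeffX.
case: (k =P m) => [->|_]; first by rewrite md eqxx.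
by rewrite mulr0 if_same.
Qed.

Lemma pihomog_eq0 d p : (forall m, m \in msupp p -> mdeg m != d) ->
  pihomog mdeg d p = 0.
Proof.
move=> pd; apply/mpolyP => m; rewrite mcoeff_pihomog mcoeff0.
case: ifPn => // md; apply: memN_msupp_eq0; apply/negP => /pd.
by rewrite md.
Qed.

(** The component of lowest possible degree is multiplicative, since any other
pair of components contributes in a higher degree. *)
Lemma pihomog_lowest_mul p q D E : mdeg_ge p D -> mdeg_ge q E ->
  pihomog mdeg (D + E) (p * q) = pihomog mdeg D p * pihomog mdeg E q.
Proof.
have rest_gt r B m : mdeg_ge r B -> m \in msupp (r - pihomog mdeg B r) ->
    (B < mdeg m)%N.
  move=> rB; rewrite mcoeff_msupp mcoeffB mcoeff_pihomog ltn_neqAle.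
  rewrite [B == _]eq_sym; case: (mdeg m =P B) => [_|_]; first by rewrite subrr eqxx.
  by rewrite subr0 -mcoeff_msupp => /rB ->; rewrite andbT.
move=> pD qE; set p0 := pihomog _ D p; set q0 := pihomog _ E q.
have -> : p * q = p0 * q0 + (p0 * (q - q0) + (p - p0) * q) by ring.
rewrite raddfD /= pihomog_dE; last by apply: dhomogM; exact: pihomogP.
rewrite pihomog_eq0 ?addr0 // => m /msuppD_le; rewrite mem_cat neq_ltn.
case/orP => /msuppM_le/allpairsP[[k l] /= [kp lq ->]]; rewrite mdegD; apply/orP; right.
  have /dhomogP/(_ k kp) kD : p0 \is D.-homog by exact: pihomogP.
  by have := rest_gt _ _ _ qE lq; rewrite kD; lia.
by have := rest_gt _ _ _ pD kp; have := qE _ lq; lia.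
Qed.

End LowestForms.

(** * The fiber cone of an equigenerated monomial ideal *)

Section PolynomialMonomials.
Local Open Scope ring_scope.

Lemma coef_monomial (R : nzRingType) (c : R) k j :
  (c%:P * 'X^k)`_j = if j == k then c else 0.
Proof. by rewrite coefCM coefXn; case: eqP; rewrite ?mulr1 ?mulr0. Qed.

Lemma horner1_monomial (R : nzRingType) (q : {poly R}) (k : nat) (c : R) :
  (forall j, q`_j = if j == k then c else 0) -> q.[1] = c.
Proof.
move=> qE; suff -> : q = c%:P * 'X^k.
  by rewrite hornerCM hornerXn expr1n mulr1.
by apply/polyP => j; rewrite qE coef_monomial.
Qed.

End PolynomialMonomials.

Section FiberConeEmbedding.
Local Open Scope ring_scope.
Local Open Scope classical_set_scope.
Variables (n : nat) (K : fieldType) (G : set 'X_{1..n}) (d : nat).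
Hypothesis Gd : forall g, G g -> mdeg g = d.
Local Notation I := (@monomial_ideal_gen n K G).

Lemma ideal_exp_mdeg_ge k p : ideal_exp I k p -> mdeg_ge p (k * d).
Proof.
rewrite ideal_exp_monomial => /monomial_ideal_genP pG m /pG[g Gg le_gm].
by rewrite -(mnm_mul_set_mdeg Gd Gg) mdeg_lepm.
Qed.

(** As [I^k] is generated by monomials of degree [k d], a monomial of [I^k] of
degree greater than [k d] is a proper multiple of a generator, hence lies in
[m I^k]; and every monomial of [m I^k] has degree greater than [k d]. *)
Lemma maxideal_mul_expP k p : ideal_exp I k p ->
  ideal_mul (@maxideal n K) (ideal_exp I k) p <-> pihomog mdeg (k * d) p = 0.
Proof.
move=> Ip; rewrite maxideal_monomial ideal_exp_monomial ideal_mul_monomial; split.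
  move=> /monomial_ideal_genP pG; apply: pihomog_eq0 => m /pG[].
  move=> _ [_ [i _ <-] [g Gg <-]] /mdeg_lepm; rewrite mdegD mdeg1 (mnm_mul_set_mdeg Gd Gg).
  by rewrite neq_ltn => ->; rewrite orbT.
move=> p0; apply/monomial_ideal_genP => m pm.
have := Ip; rewrite ideal_exp_monomial => /monomial_ideal_genP/(_ m pm)[g Gg le_gm].
have [|i le_m] := lepm_proper le_gm.
  rewrite (mnm_mul_set_mdeg Gd Gg); apply/eqP => md; move: pm.
  rewrite mcoeff_msupp; have := mcoeff_pihomog (k * d) p m.
  by rewrite -md eqxx p0 mcoeff0 => <-; rewrite eqxx.
by exists (U_(i) + g)%MM => //; exists U_(i)%MM; [exists i|exists g].
Qed.

(** The grading variable is kept here, so that multiplicativity can be checked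
coefficientwise by the Cauchy product. *)
Definition lowest_forms (p : rees I) : {poly {mpoly K[n]}} :=
  \poly_(k < size (val p)) pihomog mdeg (k * d) (val p)`_k.

Lemma coef_lowest_forms p k :
  (lowest_forms p)`_k = pihomog mdeg (k * d) (val p)`_k.
Proof. by rewrite coef_poly; case: ltnP => // /(nth_default 0) ->; rewrite raddf0. Qed.

Lemma rees_coef (p : rees I) k : ideal_exp I k (val p)`_k.
Proof. by have /asboolP := valP p. Qed.

Lemma lowest_forms_zmod_morphism : zmod_morphism lowest_forms.
Proof.
by move=> p q; apply/polyP => k; rewrite coefB !coef_lowest_forms rmorphB coefB raddfB.
Qed.

Lemma lowest_forms_monoid_morphism : monoid_morphism lowest_forms.
Proof.
split=> [|p q]; apply/polyP => k.
  rewrite coef_lowest_forms rmorph1 !coef1.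
  case: k => [|k]; last by rewrite raddf0.
  by rewrite mul0n pihomog_dE // dhomog1.
rewrite coef_lowest_forms rmorphM !coefM raddf_sum; apply: eq_bigr => i _.
rewrite !coef_lowest_forms -pihomog_lowest_mul; try exact/ideal_exp_mdeg_ge/rees_coef.
by rewrite -mulnDl subnKC // -ltnS.
Qed.

HB.instance Definition _ := GRing.isZmodMorphism.Build (rees I) {poly {mpoly K[n]}}
  lowest_forms lowest_forms_zmod_morphism.
HB.instance Definition _ := GRing.isMonoidMorphism.Build (rees I) {poly {mpoly K[n]}}
  lowest_forms lowest_forms_monoid_morphism.

(** Setting the grading variable to 1 loses nothing when [d > 0], since the
coefficients of [lowest_forms p] have distinct degrees [k * d]. *)
Definition fiber_form (p : rees I) : {mpoly K[n]} := (lowest_forms p).[1].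

Hypothesis d_gt0 : (0 < d)%N.

Lemma fiber_form_eq0 p : (fiber_form p == 0) = (p \in @fiber_ideal n K I).
Proof.
apply/eqP/asboolP => [fp0 k|Ip].
  apply/(maxideal_mul_expP (rees_coef p k)); apply/mpolyP => m.
  rewrite mcoeff_pihomog mcoeff0; case: eqP => // md.
  have /mpolyP/(_ m) := fp0; rewrite mcoeff0 /fiber_form horner_coef raddf_sum /=.
  under eq_bigr do rewrite expr1n mulr1 coef_lowest_forms mcoeff_pihomog md eqn_pmul2r //.
  case: (ltnP k (size (lowest_forms p))) => [ltk|/(nth_default 0)].
    rewrite (bigD1 (Ordinal ltk)) //= eqxx big1 ?addr0 // => i /negbTE.
    by rewrite -val_eqE /= eq_sym => ->.
  by rewrite coef_lowest_forms => /mpolyP/(_ m); rewrite mcoeff_pihomog md eqxx mcoeff0.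
rewrite /fiber_form (_ : lowest_forms p = 0) ?horner0 //; apply/polyP => k.
by rewrite coef_lowest_forms coef0; apply/(maxideal_mul_expP (rees_coef p k)).
Qed.

HB.instance Definition _ :=
  GRing.RMorphism.copy fiber_form (horner_eval (1 : {mpoly K[n]}) \o lowest_forms).

Definition fiber_embed (x : fiber_cone I) : {mpoly K[n]} := fiber_form (repr x).

Local Open Scope quotient_scope.

Lemma fiber_embed_pi p : fiber_embed (\pi_(fiber_cone I) p) = fiber_form p.
Proof.
apply/eqP; rewrite -subr_eq0 -rmorphB fiber_form_eq0.
have := Quotient.idealrBE (fiber_idealr I) (repr (\pi_(fiber_cone I) p)) p.
by rewrite reprK eqxx.
Qed.

Lemma fiber_embed_zmod_morphism : zmod_morphism fiber_embed.
Proof.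
by elim/quotW => p; elim/quotW => q; rewrite -rmorphB !fiber_embed_pi rmorphB.
Qed.

Lemma fiber_embed_monoid_morphism : monoid_morphism fiber_embed.
Proof.
split=> [|]; first by rewrite -(rmorph1 (\pi_(fiber_cone I))) fiber_embed_pi rmorph1.
by elim/quotW => p; elim/quotW => q; rewrite -rmorphM !fiber_embed_pi rmorphM.
Qed.

HB.instance Definition _ := GRing.isZmodMorphism.Build (fiber_cone I) {mpoly K[n]}
  fiber_embed fiber_embed_zmod_morphism.
HB.instance Definition _ := GRing.isMonoidMorphism.Build (fiber_cone I) {mpoly K[n]}
  fiber_embed fiber_embed_monoid_morphism.

Lemma fiber_embed_inj : injective fiber_embed.
Proof.
elim/quotW => p; elim/quotW => q; rewrite !fiber_embed_pi => /eqP.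
rewrite -subr_eq0 -rmorphB fiber_form_eq0 => Ipq.
by apply/eqP; rewrite -Quotient.idealrBE.
Qed.

Lemma monomial_rees_subproof (c : {mpoly K[n]}) k : ideal_exp I k c ->
  c%:P * 'X^k \in @rees_pred n K I.
Proof.
move=> Ic; apply/asboolP => j; rewrite coefCM coefXn.
by case: eqP => [->|_]; rewrite ?mulr1 // mulr0; exact: ideal_exp0.
Qed.

Lemma fiber_embed_onto k (f : {mpoly K[n]}) : ideal_exp I k f ->
  exists x, fiber_embed x = pihomog mdeg (k * d) f.
Proof.
move=> If; exists (\pi_(fiber_cone I) (Rees (monomial_rees_subproof If))).
rewrite fiber_embed_pi; apply: horner1_monomial (k) _ _ => j.
rewrite coef_lowest_forms; set p := (X in pihomog _ _ X).
have -> : p = if j == k then f else 0 by exact: coef_monomial.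
by case: eqP => [->|_] //; rewrite raddf0.
Qed.

(** The equation on the images serves to locate elements in the fiber cone: the
scalars for [k = 0] and the generators of [I] for [k = 1]. *)
Lemma fiber_cone_embedding :
  exists2 Phi : {rmorphism fiber_cone I -> {mpoly K[n]}}, injective Phi &
    forall k (f : {mpoly K[n]}), ideal_exp I k f ->
      exists x, Phi x = pihomog mdeg (k * d) f.
Proof.
exists (fiber_embed : {rmorphism fiber_cone I -> {mpoly K[n]}}).
  exact: fiber_embed_inj.
exact: fiber_embed_onto.
Qed.

End FiberConeEmbedding.

(** * Analytic spread *)

Section AnalyticSpread.
Local Open Scope ring_scope.
Local Open Scope classical_set_scope.
Variables (n : nat) (K : fieldType).

Definition kill_last (j : nat) : n.-tuple {mpoly K[n]} :=
  [tuple if (i + j < n)%N then 'X_i else 0 | i < n].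

Lemma kill_last_trans i j f : (i <= j)%N ->
  (f \mPo kill_last i) \mPo kill_last j = f \mPo kill_last j.
Proof.
move=> le_ij; rewrite [f \mPo kill_last i]comp_mpolyE [RHS]comp_mpolyE raddf_sum /=.
apply: eq_bigr => m _; rewrite comp_mpolyZ rmorph_prod; congr (_ *: _).
apply: eq_bigr => l _; rewrite rmorphXn; congr (_ ^+ _); rewrite !tnth_mktuple.
rewrite /=; case: ltnP => [_|le_n]; first by rewrite comp_mpolyXU -tnth_nth tnth_mktuple.
by rewrite comp_mpoly0 ltnNge (leq_trans le_n) // leq_add2l.
Qed.

(** The primes are the kernels of the substitutions [kill_last j] on the fiber
cone; the generator [x_o^(d-1) x_(n-j)] separates the [j]-th one from all the
previous ones because the first variable survives until [j = n]. *)
Lemma analytic_spread_monomial (G : set 'X_{1..n}) (d : nat) (o : 'I_n) :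
  (0 < d)%N -> (forall g, G g -> mdeg g = d) -> o = 0%N :> nat ->
  (forall i, G (U_(o) *+ d.-1 + U_(i))%MM) ->
  is_analytic_spread (@monomial_ideal_gen n K G) n.
Proof.
move=> d0 Gd o0 Go; pose I := @monomial_ideal_gen n K G.
have [Phi Phi_inj Phi_onto] := @fiber_cone_embedding n K G d Gd d0.
split; last first.
  move=> e; have /choice[kappa PhiK] c : exists x, Phi x = c%:MP.
    have [//|x xc] := Phi_onto 0%N c%:MP.
    exists x; rewrite xc mul0n pihomog_dE // -[c%:MP]mulr1 mul_mpolyC.
    by apply: dhomogZ; exact: dhomog1.
  exact: prime_chain_le Phi_inj PhiK.
have /choice[P PE] (j : 'I_n.+1) := kernel_prime
  (comp_mpoly (kill_last j) \o Phi : {rmorphism _ -> _}).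
exists P => i j lt_ij; split=> [x|].
  rewrite !PE /= => /eqP xi; rewrite -(kill_last_trans _ (ltnW lt_ij)) xi.
  by rewrite comp_mpoly0.
have lt_n : (n - j < n)%N by have := ltn_ord o; lia.
pose m := (U_(o) *+ d.-1 + U_(Ordinal lt_n))%MM.
have Im : ideal_exp I 1 'X_[m].
  rewrite ideal_exp_monomial; apply/monomial_ideal_genX; exists m; last exact: lepm_refl.
  by exists m; [exact: Go | exists 0%MM; rewrite ?addm0].
have [x xm] := Phi_onto _ _ Im.
have {}xm : Phi x = 'X_[m].
  by rewrite xm mul1n pihomog_dE // dhomogX; apply/eqP; exact: Gd (Go _).
have killX (l : nat) : 'X_[m] \mPo kill_last l =
    (if (l < n)%N then 'X_o else 0) ^+ d.-1 * (if (l < j)%N then 'X_(Ordinal lt_n) else 0).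
  rewrite /m mpolyXD -mpolyXn rmorphM rmorphXn /= !comp_mpolyXU -!tnth_nth !tnth_mktuple.
  rewrite o0 add0n /=; congr (_ * _); congr (if _ then _ else _).
  by have := ltn_ord j; have := ltn_ord o; lia.
exists x; rewrite PE /= xm killX; first by rewrite ltnn mulr0.
rewrite lt_ij ifT ?mulf_neq0 ?expf_neq0 -?msize_poly_eq0 ?msizeX //.
by have := ltn_ord j; lia.
Qed.

End AnalyticSpread.
(** * Number of generators of an equigenerated monomial ideal *)

Section NumberOfGenerators.
Local Open Scope ring_scope.
Local Open Scope classical_set_scope.

Lemma ideal_gen_seqP (R : comNzRingType) (t : seq R) (f : R) :
  ideal_gen [set` t] f -> exists c : 'I_(size t) -> R, f = \sum_i c i * t`_i.
Proof.
move=> [s st ->]; elim: s st => [|x s IHs] st.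
  by exists (fun=> 0); rewrite big_nil big1 // => i _; rewrite mul0r.
have [y sy|c sc] := IHs; first by apply: st; rewrite inE sy orbT.
have /= tx : x.2 \in t by apply: st; rewrite mem_head.
have lt_x : (index x.2 t < size t)%N by rewrite index_mem.
exists (fun i => (if i == Ordinal lt_x then x.1 else 0) + c i).
rewrite big_cons sc; under [RHS]eq_bigr do rewrite mulrDl.
rewrite big_split /= [X in _ = X + _](bigD1 (Ordinal lt_x)) //= eqxx nth_index //.
by rewrite [X in _ + X + _]big1 ?addr0 // => i /negbTE ->; rewrite mul0r.
Qed.

Lemma is_mu_uniq (R : comNzRingType) (I : set R) k l : is_mu I k -> is_mu I l -> k = l.
Proof.
by move=> [Ik mink] [Il minl]; apply/eqP; rewrite eqn_leq mink // minl.
Qed.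

Variables (n : nat) (K : fieldType).

Lemma mcoeffM_lowest (c h : {mpoly K[n]}) (m : 'X_{1..n}) :
  mdeg_ge h (mdeg m) -> (c * h)@_m = c@_0%MM * h@_m.
Proof.
move=> h_ge; have c_ge : mdeg_ge c 0 by [].
have := mcoeff_pihomog (0 + mdeg m) (c * h) m.
rewrite eqxx pihomog_lowest_mul // => <-.
have -> : pihomog mdeg 0 c = (c@_0%MM)%:MP.
  apply/mpolyP => k; rewrite mcoeff_pihomog mcoeffC mdeg_eq0 eq_sym.
  by case: eqP => [->|_]; rewrite ?mulr1 ?mulr0.
by rewrite mcoeffCM mcoeff_pihomog eqxx.
Qed.

(** In degree [d] only the constant terms of the coefficients matter, so the
degree [d] parts of any generators span the [size s]-dimensional space with
basis the monomials of [s]. *)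
Lemma is_mu_monomial (s : seq 'X_{1..n}) (d : nat) :
  uniq s -> (forall m, m \in s -> mdeg m = d) ->
  is_mu (@monomial_ideal_gen n K [set` s]) (size s).
Proof.
move=> s_uniq sd; split.
  exists [seq 'X_[m] | m <- s]; last by rewrite size_map.
  congr ideal_gen; apply/seteqP; split=> f /=.
    by move=> [m sm <-]; apply: map_f.
  by move=> /mapP[m sm ->]; exists m.
move=> k [t It <-].
have t_ge (j : 'I_(size t)) : mdeg_ge t`_j d.
  have /monomial_ideal_genP tj : monomial_ideal_gen [set` s] t`_j.
    by rewrite It; apply: ideal_gen_sub; exact: mem_nth.
  by move=> m /tj[g /sd <- /mdeg_lepm].
pose a (i : 'I_(size s)) := nth 0%MM s i.
have /choice[c ctE] (i : 'I_(size s)) :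
    exists c : 'I_(size t) -> {mpoly K[n]}, 'X_[a i] = \sum_j c j * t`_j.
  apply: ideal_gen_seqP; rewrite -It; apply: ideal_gen_sub.
  by exists (a i) => //; exact: mem_nth.
pose C := \matrix_(i < size s, j < size t) (c i j)@_0%MM.
pose V := \matrix_(j < size t, i < size s) (t`_j)@_(a i).
have CV : C *m V = 1%:M.
  apply/matrixP => i l; rewrite !mxE.
  have <- : ('X_[a i])@_(a l) = (i == l)%:R :> K.
    by rewrite mcoeffX /a nth_uniq.
  rewrite ctE raddf_sum /=; apply: eq_bigr => j _; rewrite !mxE mcoeffM_lowest //.
  by rewrite sd ?mem_nth.
by rewrite -(mxrank1 K (size s)) -CV mulmx_max_rank.
Qed.

Lemma is_min_mon_gens_equidegree (G : set 'X_{1..n}) (d : nat) :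
  (forall g, G g -> mdeg g = d) -> is_min_mon_gens (@monomial_ideal_gen n K G) G.
Proof.
move=> Gd; split=> // H HG GH; apply/seteqP; split=> // g Gg.
have : monomial_ideal_gen (K := K) G 'X_[g].
  by apply/monomial_ideal_genX; exists g => //; exact: lepm_refl.
rewrite GH => /monomial_ideal_genX[h Hh le_hg].
by rewrite -(lepm_mdeg_eq le_hg) // !Gd //; exact: HG.
Qed.

End NumberOfGenerators.
(** * Principal Borel ideals in three variables *)

Section StableShift.
Local Open Scope nat_scope.
Local Open Scope classical_set_scope.

Lemma strongly_stable_shift (n : nat) (K : fieldType) (I : set {mpoly K[n]})
    (i j : 'I_n) (k : nat) (w : 'X_{1..n}) :
  strongly_stable I -> i < j ->
  I 'X_[(w + U_(j) *+ k)%MM] -> I 'X_[(w + U_(i) *+ k)%MM].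
Proof.
move=> stI lt_ij; elim: k w => [|k IHk] w; first by rewrite !mulm0n.
rewrite !mulmS => Iw.
have /(strongly_stableX stI Iw)/(_ lt_ij) : 0 < (w + (U_(j) + U_(j) *+ k))%MM j.
  by rewrite !mnmDE mnm1E eqxx; lia.
rewrite !addmA (_ : (_ - _ + _)%MM = (w + U_(i) + U_(j) *+ k)%MM); first exact: IHk.
by apply/mnmP => l; rewrite !(mnmDE, mnmBE); lia.
Qed.

End StableShift.

Section ThreeVariables.
Local Open Scope nat_scope.
Local Open Scope classical_set_scope.

Definition x1 : 'I_3 := @Ordinal 3 0 isT.
Definition x2 : 'I_3 := @Ordinal 3 1 isT.
Definition x3 : 'I_3 := @Ordinal 3 2 isT.

Lemma ord3P (i : 'I_3) : [\/ i = x1, i = x2 | i = x3].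
Proof.
by case: i => -[|[|[|//]]] lt_i3; [apply: Or31|apply: Or32|apply: Or33]; apply: val_inj.
Qed.

Definition mnm3 (a b c : nat) : 'X_{1..3} := [multinom [tuple a; b; c]].

Lemma mnm3_x1 a b c : mnm3 a b c x1 = a. Proof. by rewrite multinomE (tnth_nth 0). Qed.
Lemma mnm3_x2 a b c : mnm3 a b c x2 = b. Proof. by rewrite multinomE (tnth_nth 0). Qed.
Lemma mnm3_x3 a b c : mnm3 a b c x3 = c. Proof. by rewrite multinomE (tnth_nth 0). Qed.
Definition mnm3E := (mnm3_x1, mnm3_x2, mnm3_x3).

Lemma mnm3P (m k : 'X_{1..3}) : m x1 = k x1 -> m x2 = k x2 -> m x3 = k x3 -> m = k.
Proof. by move=> m1 m2 m3; apply/mnmP => i; case: (ord3P i) => ->. Qed.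

Lemma mdeg3 (m : 'X_{1..3}) : mdeg m = m x1 + m x2 + m x3.
Proof.
rewrite mdegE !big_ord_recl big_ord0 addn0 addnA.
by congr (m _ + m _ + m _); apply: val_inj.
Qed.

(** These are meant for [c <= s <= d]: the monomials of degree [d] whose
exponents satisfy [m3 <= c] and [m2 + m3 <= s]. *)
Definition borel_seq (d s c : nat) : seq 'X_{1..3} :=
  [seq mnm3 (d - (y + z)) y z | z <- iota 0 c.+1, y <- iota 0 (s - z).+1].

Lemma mem_borel_seq d s c m : c <= s <= d ->
  (m \in borel_seq d s c) = [&& mdeg m == d, m x2 + m x3 <= s & m x3 <= c].
Proof.
move=> /andP[le_cs le_sd]; apply/allpairsPdep/and3P => [[z [y []]]|[/eqP]].
  rewrite !mem_iota !add0n /= !ltnS => le_z le_y ->.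
  by rewrite mdeg3 !mnm3E; split; [apply/eqP| |]; lia.
rewrite mdeg3 => m_d m_s m_c; exists (m x3), (m x2).
rewrite !mem_iota !add0n /= !ltnS m_c; split=> //; first lia.
by apply: mnm3P; rewrite !mnm3E //; lia.
Qed.

Lemma uniq_borel_seq d s c : uniq (borel_seq d s c).
Proof.
apply: allpairs_uniq_dep => [|z _|]; [exact: iota_uniq|exact: iota_uniq|].
move=> [z y] [z' y'] _ _ /= /mnmP yz; have := yz x2; have := yz x3.
by rewrite !mnm3E => -> ->.
Qed.

Lemma size_borel_seq d s c : c <= s ->
  2 * size (borel_seq d s c) = c.+1 * (2 * s + 2 - c).
Proof.
rewrite size_allpairs_dep; elim: c => [|c IHc] le_cs.
  by rewrite /= size_iota; lia.
rewrite -(addn1 c.+1) iotaD add0n map_cat sumn_cat mulnDr IHc; last lia.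
by rewrite /= size_iota; nia.
Qed.

Section PrincipalBorel.
Variable K : fieldType.
Local Notation mon := (@monomial_ideal_gen 3 K).

Lemma borel_seq_mdeg d s c m : c <= s <= d -> [set` borel_seq d s c] m -> mdeg m = d.
Proof. by move=> csd /=; rewrite mem_borel_seq // => /and3P[/eqP]. Qed.

Lemma strongly_stable_borel_seq d s c : c <= s <= d ->
  strongly_stable (mon [set` borel_seq d s c]).
Proof.
move=> csd; exists [set` borel_seq d s c].
  by apply: is_min_mon_gens_equidegree => m; exact: borel_seq_mdeg.
move=> u /=; rewrite mem_borel_seq // mdeg3 => /and3P[/eqP ud us uc] j uj i lt_ij.
apply: ideal_gen_sub; exists (u - U_(j) + U_(i))%MM => //=.
rewrite mem_borel_seq // mdeg3 !mnmDE !mnmBE !mnm1E.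
by case: (ord3P i) (ord3P j) lt_ij uj => [] -> [] -> //= _; lia.
Qed.

(** From [u], moving [a3 - m3] units from [x3] to [x2], then the excess in [x2] to
[x1], reaches any given [m]. *)
Lemma principal_borelE a1 a2 a3 :
  principal_borel K (mnm3 a1 a2 a3) =
  mon [set` borel_seq (a1 + a2 + a3) (a2 + a3) a3].
Proof.
have csd : a3 <= a2 + a3 <= a1 + a2 + a3 by lia.
have [_ _ minB] := principal_borelP K (mnm3 a1 a2 a3).
apply/seteqP; split.
  apply: minB; first exact: strongly_stable_borel_seq.
  apply: ideal_gen_sub; exists (mnm3 a1 a2 a3) => //=.
  by rewrite mem_borel_seq // mdeg3 !mnm3E; lia.
move=> f Jf I [stI Iu]; have [H [IH _] _] := stI.
move: f Jf; rewrite IH; apply: ideal_gen_min => _ [m /= Gm <-]; rewrite -/(mon H) -IH.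
move: Gm; rewrite mem_borel_seq // mdeg3 => /and3P[/eqP md ms mc].
have {}Iu : I 'X_[(mnm3 a1 a2 (m x3) + U_(x3) *+ (a3 - m x3))%MM].
  rewrite (_ : (_ + _)%MM = mnm3 a1 a2 a3) //.
  by apply: mnm3P; rewrite mnmDE mulmnE mnm1E !mnm3E /=; lia.
have {}Iu := strongly_stable_shift (i := x2) (j := x3) stI isT Iu.
set r := a2 + a3 - (m x2 + m x3).
have {}Iu : I 'X_[(mnm3 a1 (m x2) (m x3) + U_(x2) *+ r)%MM].
  rewrite (_ : (_ + _)%MM = (mnm3 a1 a2 (m x3) + U_(x2) *+ (a3 - m x3))%MM) //.
  by apply: mnm3P; rewrite !mnmDE !mulmnE mnm1E !mnm3E /=; lia.
have {}Iu := strongly_stable_shift (i := x1) (j := x2) stI isT Iu.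
rewrite (_ : m = (mnm3 a1 (m x2) (m x3) + U_(x1) *+ r)%MM) //.
by apply: mnm3P; rewrite !mnmDE !mulmnE mnm1E !mnm3E /=; lia.
Qed.

Lemma borel_seq_square d s c : c <= s <= d ->
  ideal_exp (mon [set` borel_seq d s c]) 2 =
  mon [set` borel_seq (2 * d) (2 * s) (2 * c)].
Proof.
move=> csd; have csd2 : 2 * c <= 2 * s <= 2 * d by lia.
rewrite ideal_exp_monomial; congr monomial_ideal_gen; apply/seteqP; split=> m /=.
  move=> [g Gg [_ [h Gh [_ -> <-]] <-]]; rewrite addm0; move: Gg Gh => /=.
  rewrite !mem_borel_seq // !mdeg3 !mnmDE => /and3P[/eqP gd gs gc] /and3P[/eqP hd hs hc].
  by apply/and3P; split; lia.
rewrite mem_borel_seq // mdeg3 => /and3P[/eqP md ms mc].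
(* The floors and the ceilings of m3 / 2 and (m2 + m3) / 2 both stay within
   the bounds, and halving preserves m3 <= m2 + m3. *)
pose z := m x3 %/ 2; pose t := (m x2 + m x3) %/ 2.
pose g := mnm3 (d - t) (t - z) z.
pose h := mnm3 (m x1 - (d - t)) (m x2 - (t - z)) (m x3 - z).
exists g; first by rewrite /= mem_borel_seq // mdeg3 !mnm3E; lia.
exists h; last by apply: mnm3P; rewrite mnmDE !mnm3E; lia.
exists h; first by rewrite /= mem_borel_seq // mdeg3 !mnm3E; lia.
by exists 0%MM; rewrite ?addm0.
Qed.

Lemma principal_borel_analytic_spread a1 a2 a3 : 0 < a3 ->
  is_analytic_spread (principal_borel K (mnm3 a1 a2 a3)) 3.
Proof.
move=> a3_gt0; rewrite principal_borelE.
have csd : a3 <= a2 + a3 <= a1 + a2 + a3 by lia.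
apply: (@analytic_spread_monomial 3 K _ (a1 + a2 + a3) x1) => //; first lia.
  by move=> g; exact: borel_seq_mdeg.
move=> i /=; rewrite mem_borel_seq // mdeg3 !mnmDE !mulmnE !mnm1E.
by case: (ord3P i) => -> /=; lia.
Qed.

Lemma principal_borel_freiman_eq a1 a2 a3 : 0 < a3 ->
  freiman (principal_borel K (mnm3 a1 a2 a3)) <->
  size (borel_seq (2 * (a1 + a2 + a3)) (2 * (a2 + a3)) (2 * a3)) + 3 =
  3 * size (borel_seq (a1 + a2 + a3) (a2 + a3) a3).
Proof.
move=> a3_gt0; have csd : a3 <= a2 + a3 <= a1 + a2 + a3 by lia.
have spread := principal_borel_analytic_spread a1 a2 a3_gt0.
set I := principal_borel _ _ in spread *.
set s := borel_seq (a1 + _ + _) _ _; set s2 := borel_seq _ _ _.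
have IE : I = mon [set` s] by exact: principal_borelE.
have sd m : m \in s -> mdeg m = a1 + a2 + a3 by exact: borel_seq_mdeg.
have mu1 : is_mu I (size s).
  by rewrite IE; apply: is_mu_monomial sd; exact: uniq_borel_seq.
have mu2 : is_mu (ideal_exp I 2) (size s2).
  rewrite IE borel_seq_square //.
  apply: (@is_mu_monomial _ _ _ (2 * (a1 + a2 + a3))) => [|m].
    exact: uniq_borel_seq.
  by apply: borel_seq_mdeg; lia.
split=> [[_ [l [k1 [k2 [spread' k1P k2P]]]]]|size_eq].
  have -> : l = 3.
    by apply/eqP; rewrite eqn_leq spread.2 ?spread'.2 //; [exact: spread.1|exact: spread'.1].
  by rewrite (is_mu_uniq k1P mu1) (is_mu_uniq k2P mu2) (_ : 'C(3, 2) = 3) //; lia.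
split.
  exists [set` s]; first by rewrite IE; exact: is_min_mon_gens_equidegree sd.
  by exists (a1 + a2 + a3).
exists 3, (size s), (size s2); split=> //.
rewrite (_ : 'C(3, 2) = 3) //; lia.
Qed.

End PrincipalBorel.
End ThreeVariables.

Theorem theorem3p3 (K : fieldType) (a1 a2 a3 : nat) (ha3 : (1 <= a3)%N) :
  freiman (principal_borel K [multinom [tuple a1; a2; a3]]) <->
  a3 = 1%N \/ (a3 = 2%N /\ a2 = 0%N).
Proof.
rewrite principal_borel_freiman_eq //.
have sz1 := @size_borel_seq (a1 + a2 + a3) (a2 + a3) a3 (leq_addl _ _).
have sz2 := @size_borel_seq (2 * (a1 + a2 + a3)) (2 * (a2 + a3)) (2 * a3)
  (leq_mul (leqnn 2) (leq_addl _ _)).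
move: (size _) (size _) sz1 sz2 => k1 k2 sz1 sz2.
rewrite (_ : _ - _ = 2 * a2 + a3 + 2)%N in sz1; last lia.
rewrite (_ : _ - _ = 4 * a2 + 2 * a3 + 2)%N in sz2; last lia.
case: a3 ha3 sz1 sz2 => // b _ sz1 sz2.
(* With a3 = b + 1 the equation reads b (2 a2 + b - 1) = 0. *)
have -> : (k1 + 3 = 3 * k2)%N <-> (b * (2 * a2 + b) = b)%N by lia.
case: b {sz1 sz2} => [|b]; first by split=> // _; left.
split; first by rewrite -[RHS]muln1 => /eqP; rewrite eqn_pmul2l //; lia.
by case=> [|[[->] ->]].
Qed.
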